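(* Let $0<\ell\le\infty$, $1\le p<\infty$, $0\le\lambda<1$, $\beta\in\mathbb{R}$, and let $\frac1p+\frac1{p'}=1$. The operator $H_\beta$ is bounded in the Morrey space $\mathcal{L}^{p,\lambda}([0,\ell])$ if and only if $$\beta<\frac{\lambda}{p}+\frac{1}{p'},$$ and the operator $\mathcal{H}_\beta$ is bounded in the Morrey space $\mathcal{L}^{p,\lambda}([0,\ell])$ if and only if $$\beta>\frac{\lambda}{p}-\frac1p .$$
   Context: For an interval $E\subseteq\mathbb{R}$, the Morrey space $\mathcal{L}^{p,\lambda}(E)$ is the space of measurable functions with finite norm $$\|f\|_{p,\lambda}=\sup_{x\in E,\ r>0}\left\{\frac1{r^\lambda}\int_{\{y\in E:\ |y-x|<r\}}|f(y)|^p\,dy\right\}^{1/p}.$$ (For $\ell=\infty$, $[0,\ell]$ means $[0,\infty)$.) The weighted Hardy operators are $$H_\beta f(x)=x^{\beta-1}\int_0^x\frac{f(t)\,dt}{t^\beta},\qquad \mathcal{H}_\beta f(x)=x^\beta\int_x^\ell\frac{f(t)\,dt}{t^{\beta+1}},\qquad 0<x<\ell.$$ *)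

(* Defs.v *)
From HB Require Import structures.
From mathcomp Require Import all_boot all_order all_algebra.
From mathcomp Require Import all_classical all_reals all_analysis.

Set Implicit Arguments.
Unset Strict Implicit.
Unset Printing Implicit Defensive.

Import Order.TTheory GRing.Theory Num.Theory.
Import numFieldNormedType.Exports.

Local Open Scope classical_set_scope.
Local Open Scope ring_scope.

Section morrey.
Context {R : realType}.
Implicit Types (f : R -> R) (E : set R) (p lambda beta x : R) (l : \bar R).

Local Notation mu := (@lebesgue_measure R).

Definition morrey_norm p lambda E f : \bar R :=
  ereal_sup [set z | exists x r : R, [/\ E x, (0 < r)%R &
    z = ((((r `^ lambda)^-1)%R%:E *
          \int[mu]_(y in [set y | E y /\ (`|y - x| < r)%R])
             (`|f y| `^ p)%R%:E) `^ (p^-1)%R)%E]].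

(* The functions are total on R but only their restriction to E matters. *)
Definition morrey p lambda E : set (R -> R) :=
  [set f | measurable_fun E f /\ (morrey_norm p lambda E f < +oo)%E].

(* The interval [0, l], which is [0, +oo[ when l = +oo. *)
Definition segment0 l : set R := [set x | (0 <= x%:E <= l)%E].

Definition hardy beta f x : R :=
  x `^ (beta - 1) * \int[mu]_(t in `]0, x[) (f t / t `^ beta).

Definition hardy_dual l beta f x : R :=
  x `^ beta *
  \int[mu]_(t in [set t : R | (x%:E < t%:E < l)%E]) (f t / t `^ (beta + 1)).

(* Since [\int] is total, with a default value on non-integrable functions,
   the fact that the operators are defined at f, i.e., that the defining
   integrals converge for all 0 < x < l, has to be stated separately. *)
Definition hardy_defined l beta f : Prop :=
  forall x, (0 < x%:E < l)%E ->
    mu.-integrable `]0, x[ (fun t => (f t / t `^ beta)%:E).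

Definition hardy_dual_defined l beta f : Prop :=
  forall x, (0 < x%:E < l)%E ->
    mu.-integrable [set t : R | (x%:E < t%:E < l)%E]
      (fun t => (f t / t `^ (beta + 1))%:E).

Definition morrey_bounded p lambda E (defined : (R -> R) -> Prop)
    (T : (R -> R) -> R -> R) : Prop :=
  (forall f, morrey p lambda E f -> defined f /\ morrey p lambda E (T f)) /\
  exists C : R, forall f, morrey p lambda E f ->
    (morrey_norm p lambda E (T f) <= C%:E * morrey_norm p lambda E f)%E.

End morrey.

(* Main.v *)
Require Import Defs.
From mathcomp Require Import all_boot all_order all_algebra.
From mathcomp Require Import all_classical all_reals all_analysis.
From mathcomp Require Import measurable_realfun ring lra.

Set Implicit Arguments.
Unset Strict Implicit.
Unset Printing Implicit Defensive.

Import Order.TTheory GRing.Theory Num.Theory.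
Import numFieldNormedType.Exports.

Local Open Scope classical_set_scope.
Local Open Scope ring_scope.

(** Put [gamma := (lambda - 1) / p]. The substitution [t = y * s] writes both Hardy
    operators as superpositions of dilates of [f], namely as the integral of
    [f (y * s) * s `^ (- b)] over [s] in [S], with [S = `]0, 1[] and [b = beta] for
    [hardy], and with [S = `]1, +oo[] and [b = beta + 1] for [hardy_dual], the
    function [f] being extended by [0] beyond [l].

    Sufficiency. Dilating by [s] multiplies the Morrey norm by at most
    [s `^ gamma] ([integral_dilation_window]), so Minkowski's integral inequality
    ([minkowski_integral]) bounds the norm of the operator by the integral of
    [s `^ (gamma - b)] over [S]. That integral converges exactly when
    [beta < gamma + 1] in the first case and when [beta > gamma] in the second
    case: these are the two conditions of the theorem. The same estimate
    shows that the defining integrals converge almost everywhere, and then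
    everywhere by monotonicity ([operator_defined]).

    Necessity. The power of exponent [gamma] scales in the same way as the Morrey
    norm, but for [lambda = 0] its [p]-th power is not integrable at the origin.
    Hence the test functions are the powers of exponent [gamma + e] with small
    [e > 0], truncated to [`]0, a[]; uniformly in [e], their norms are
    comparable with the contribution of any window around the origin whose
    radius [rho] keeps [rho `^ e] away from [0]. When the condition on [beta]
    fails, the kernel [s `^ (gamma + e - b)] dominates [s `^ (e - 1)] on [S], so
    near the origin the operator multiplies the test function by at least [e^-1];
    letting [e] tend to [0] rules out a finite norm ([not_morrey_bounded]). The
    argument treats [lambda = 0] and [lambda > 0], the critical and the
    supercritical exponents, at once. *)

(** * Jensen's inequality for weighted power means *)

Section weighted_mean.
Context d (T : measurableType d) (R : realType) (mu : {measure set T -> \bar R}).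
Local Open Scope ereal_scope.

(** Jensen's inequality for the measure of density [w], which need not have mass 1.
    It is Hölder's inequality for the factors [u * w `^ p^-1] and [w `^ q^-1],
    with [q] conjugate to [p]; the case [p = 1], where [q] would be infinite,
    is an equality. *)
Lemma weighted_power_mean (D : set T) (u w : T -> R) (p : R) :
  measurable D -> measurable_fun D u -> measurable_fun D w ->
  (forall x, D x -> (0 <= u x)%R) -> (forall x, D x -> (0 <= w x)%R) ->
  (1 <= p)%R ->
  (\int[mu]_(x in D) (u x * w x)%:E) `^ p <=
  (\int[mu]_(x in D) (w x)%:E) `^ (p - 1) *
    \int[mu]_(x in D) (u x `^ p * w x)%:E.
Proof.
move=> mD mu_ mw u0 w0; rewrite le_eqVlt => /predU1P[<-|p1].
  rewrite subrr poweRe0 mul1e poweRe1; last first.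
    by apply: integral_ge0 => x Dx; rewrite lee_fin mulr_ge0 ?u0 ?w0.
  rewrite le_eqVlt; apply/orP; left; apply/eqP; apply: eq_integral => x.
  by rewrite inE => Dx; rewrite powRr1 ?u0.
have p0 : (0 < p)%R by rewrite (lt_trans ltr01).
have pN0 : p != 0%R by rewrite gt_eqF.
have p10 : (0 < p - 1)%R by rewrite subr_gt0.
pose q := (p / (p - 1))%R.
have q0 : (0 < q)%R by rewrite divr_gt0.
have qN0 : q != 0%R by rewrite gt_eqF.
have pq : (p^-1 + q^-1 = 1)%R.
  by rewrite /q invf_div; field; rewrite pN0.
pose f := ((fun x => u x * w x `^ p^-1)%R \_ D).
pose g := ((fun x => w x `^ q^-1)%R \_ D).
have mf : measurable_fun [set: T] f.
  apply/(measurable_restrictT _ mD); apply: measurable_funM => //.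
  exact: (measurableT_comp (measurable_powR p^-1)).
have mg : measurable_fun [set: T] g.
  apply/(measurable_restrictT _ mD).
  exact: (measurableT_comp (measurable_powR q^-1)).
have := hoelder mu mf mg p0 q0 pq.
rewrite Lnorm1.
have -> : \int[mu]_x `|(EFin \o (f \* g)%R) x| = \int[mu]_(x in D) (u x * w x)%:E.
  rewrite [RHS]integral_mkcond; apply: eq_integral => x _.
  rewrite /f /g /= /patch; case: ifPn; last by rewrite mul0r normr0.
  rewrite inE => Dx /=; rewrite -mulrA -powRD; last first.
    by rewrite pq oner_eq0.
  by rewrite pq powRr1 ?w0// ger0_norm// mulr_ge0 ?u0 ?w0.
have fE : 'N[mu]_p%:E[EFin \o f] `^ p = \int[mu]_(x in D) (u x `^ p * w x)%:E.
  rewrite powR_Lnorm// [RHS]integral_mkcond; apply: eq_integral => x _ /=.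
  rewrite /f /= /patch; case: ifPn; last first.
    by rewrite normr0 powR0.
  rewrite inE => Dx /=; rewrite ger0_norm ?mulr_ge0 ?u0 ?powR_ge0//.
  by rewrite powRM ?u0 ?powR_ge0// -powRrM mulVf// powRr1 ?w0.
have gE : 'N[mu]_q%:E[EFin \o g] `^ p = (\int[mu]_(x in D) (w x)%:E) `^ (p - 1).
  have -> : p = (q * (p - 1))%R by rewrite /q divfK// gt_eqF.
  rewrite poweRrM; congr (_ `^ _).
    rewrite powR_Lnorm// [RHS]integral_mkcond; apply: eq_integral => x _ /=.
    rewrite /g /= /patch; case: ifPn; last first.
    by rewrite normr0 powR0.
    rewrite inE => Dx /=; rewrite ger0_norm ?powR_ge0//.
    by rewrite -powRrM mulVf// powRr1 ?w0.
  by rewrite /q divfK// gt_eqF.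
move=> fg; rewrite -fE -gE -poweRM ?Lnorm_ge0//.
have int0 : 0 <= \int[mu]_(x in D) (u x * w x)%:E.
  by apply: integral_ge0 => x Dx; rewrite lee_fin mulr_ge0 ?u0 ?w0.
apply: (gt0_ler_poweR (ltW p0)).
- by rewrite in_itv/= int0 leey.
- by rewrite in_itv/= leey andbT mule_ge0// Lnorm_ge0.
- by rewrite muleC.
Qed.

End weighted_mean.

(** * Dilations of the Lebesgue measure *)

Section dilation.
Context {R : realType}.
Local Notation mu := (@lebesgue_measure R).
Local Open Scope ereal_scope.

Lemma mul_preimage_itvoc (x a b : R) : (0 < x)%R ->
  (fun t : R => x * t)%R @^-1` `]a, b] = `](a / x)%R, (b / x)%R]%classic.
Proof.
move=> x0; apply/seteqP; split => t /=;
  by rewrite !in_itv/= ltr_pdivrMr// ler_pdivlMr// (mulrC t).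
Qed.

(** The measure of a dilated set, rescaled, is a measure that agrees with the
    Lebesgue measure on half-open intervals, hence everywhere. *)
Lemma lebesgue_measure_dilation (x : R) (A : set R) : (0 < x)%R ->
  measurable A -> mu ((fun t : R => x * t)%R @^-1` A) = x^-1%:E * mu A.
Proof.
move=> x0 mA.
pose phi : measurableTypeR R -> measurableTypeR R := (fun t : R => x * t)%R.
have mphi : measurable_fun setT phi.
  exact: mulrl_measurable.
pose pf : {measure set (measurableTypeR R) -> \bar R} :=
  measure_function_pushforward__canonical__measure_function_Measure mu mphi.
pose nu : {measure set (measurableTypeR R) -> \bar R} :=
  mscale (NngNum (ltW x0)) pf.
have nuE B : nu B = x%:E * mu (phi @^-1` B) by [].
have -> : mu A = nu A.
  apply: lebesgue_measure_unique => // _ [[a b]] _ <-.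
  rewrite nuE mul_preimage_itvoc// !lebesgue_measure_itv/= !lte_fin.
  rewrite ltr_pM2r ?invr_gt0//; case: ifPn => _; last by rewrite mule0.
  by rewrite -!EFinD -EFinM -mulrBl mulrC divfK// gt_eqF.
by rewrite nuE muleA -EFinM mulVf ?gt_eqF// mul1e.
Qed.

Lemma ge0_integral_dilation (x k : R) (h : R -> \bar R) : (0 < x)%R ->
  (0 <= k)%R -> measurable_fun [set: R] h -> (forall t, 0 <= h t) ->
  \int[mu]_t (k%:E * h (x * t)%R) = (k / x)%:E * \int[mu]_t h t.
Proof.
move=> x0 k0 mh h0.
pose phi : measurableTypeR R -> measurableTypeR R := (fun t : R => x * t)%R.
have mphi : measurable_fun setT phi.
  exact: mulrl_measurable.
rewrite ge0_integralZl//; last first.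
  exact: (measurableT_comp mh (mulrl_measurable x)).
rewrite EFinM -muleA; congr (_ * _).
pose pf : {measure set (measurableTypeR R) -> \bar R} :=
  measure_function_pushforward__canonical__measure_function_Measure mu mphi.
have -> : \int[mu]_t h (x * t)%R = \int[pf]_t h t.
  apply/esym; exact: (@ge0_integral_pushforward _ _ _ _ R phi mphi mu setT h
    measurableT mh (fun y _ => h0 y)).
have xV0 : (0 <= x^-1)%R by rewrite invr_ge0 ltW.
transitivity (\int[mscale (NngNum xV0) mu]_t h t).
  apply: (@eq_measure_integral _ (measurableTypeR R) R setT
    (mscale (NngNum xV0) mu) pf) => A mA _.
  exact: lebesgue_measure_dilation.
by rewrite ge0_integral_mscale.
Qed.

(** No integrability is assumed, so the integrals of the positive and negative
    parts may both be infinite; the conventional value [-oo] of their difference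
    is also preserved by multiplication by a positive real. *)
Lemma integral_dilation (x k : R) (h : R -> \bar R) : (0 < x)%R ->
  (0 < k)%R -> measurable_fun [set: R] h ->
  \int[mu]_t (k%:E * h (x * t)%R) = (k / x)%:E * \int[mu]_t h t.
Proof.
move=> x0 k0 mh.
rewrite integralE [in RHS]integralE.
have -> : (fun t => k%:E * h (x * t)%R)^\+ = fun t => k%:E * h^\+ (x * t)%R.
  by rewrite (ge0_funeposM (fun t => h (x * t)%R) (ltW k0)) !unlock.
have -> : (fun t => k%:E * h (x * t)%R)^\- = fun t => k%:E * h^\- (x * t)%R.
  by rewrite (ge0_funenegM (fun t => h (x * t)%R) (ltW k0)) !unlock.
rewrite !ge0_integral_dilation ?ltW//; last 2 first.
- exact: measurable_funeneg.
- exact: measurable_funepos.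
have : 0 <= \int[mu]_t h^\+ t by exact: integral_ge0.
have : 0 <= \int[mu]_t h^\- t by exact: integral_ge0.
have kx : (0 < k / x)%R by rewrite divr_gt0.
case: (\int[mu]_t h^\+ t) => [u||]; case: (\int[mu]_t h^\- t) => [v||]//= _ _.
- by congr EFin; rewrite -mulrBr.
- by rewrite gt0_muley ?lte_fin// addeNy gt0_muleNy.
- by rewrite gt0_muley ?lte_fin//= gt0_muley.
- by rewrite gt0_muley ?lte_fin//= gt0_muleNy.
Qed.

End dilation.

(** * Integrals of powers *)

Section power_integrals.
Context {R : realType}.
Local Notation mu := (@lebesgue_measure R).

Lemma measurable_powR_EFin (c : R) (D : set R) :
  measurable_fun D (fun t : R => (t `^ c)%:E).
Proof. by apply/measurable_EFinP/measurable_funTS; exact: measurable_powR. Qed.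

Lemma integral_powR (c x y : R) : 0 < x -> x < y -> c + 1 != 0 ->
  (\int[mu]_(t in `]x, y[) (t `^ c)%:E =
   ((y `^ (c + 1) - x `^ (c + 1)) / (c + 1))%:E)%E.
Proof.
move=> x0 xy c1.
rewrite -(integral_itv_bndoo true false); last exact: measurable_powR_EFin.
have pos t : x <= t -> 0 < t by exact: lt_le_trans.
pose F : R -> R := fun t => (c + 1)^-1 * (t `^ (c + 1)).
have dF (t : R) : 0 < t -> is_derive t 1 F (t `^ c).
  move=> t0; have := is_derive1_powR (c + 1) t0.
  rewrite addrK => h; rewrite (_ : t `^ c = (c + 1)^-1 *: ((c + 1) * t `^ c)).
    exact: is_deriveZ.
  by rewrite /GRing.scale/= mulKf.
have cF (t : R) : 0 < t -> {for t, continuous F}.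
  move=> t0; apply: differentiable_continuous; apply/derivable1_diffP.
  by have [] := dF _ t0.
rewrite (@continuous_FTC2 _ _ F)//.
- by rewrite /F /GRing.scale/= -EFinB -mulrBr mulrC.
- apply: continuous_in_subspaceT => t; rewrite inE/= in_itv/= => /andP[xt _].
  apply: differentiable_continuous; apply/derivable1_diffP.
  by have [] := is_derive1_powR c (pos _ xt).
- split.
  + move=> t; rewrite in_itv/= => /andP[/ltW xt _].
    by have [] := dF _ (pos _ xt).
  + by apply: cvg_at_right_filter; exact: cF.
  + by apply: cvg_at_left_filter; apply: cF; rewrite (lt_trans x0).
- move=> t; rewrite in_itv/= => /andP[/ltW xt _].
  by rewrite derive1E; have [] := dF _ (pos _ xt).
Qed.

Lemma integral_powR0 (c x : R) : -1 < c -> 0 < x ->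
  (\int[mu]_(t in `]0%R, x[) (t `^ c)%:E = (x `^ (c + 1) / (c + 1))%:E)%E.
Proof.
move=> c1 x0.
have c0 : 0 < c + 1 by rewrite -ltrBlDr sub0r.
pose u (n : nat) : R := x * (n.+2%:R)^-1.
have u0 n : 0 < u n by rewrite mulr_gt0// invr_gt0.
have ux n : u n < x by rewrite gtr_pMr// invf_lt1// ltr1n.
pose F n := `](u n), x[%classic : set R.
have ndF : nondecreasing_seq F.
  move=> m n mn; rewrite subsetEset => t; rewrite /F/= !in_itv/= => /andP[um ->].
  rewrite andbT; apply: le_lt_trans um; rewrite ler_pM2l// lef_pV2 ?posrE//.
  by rewrite ler_nat !ltnS.
have ucvg : u n @[n --> \oo] --> (0 : R).
  rewrite -[X in _ --> X](mulr0 x); apply: cvgM; first exact: cvg_cst.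
  have := @cvg_harmonic R; rewrite -(cvg_shiftS (@harmonic R)).
  exact.
have UF : \bigcup_n F n = `]0, x[%classic.
  apply/seteqP; split => [t [n _]|t]; rewrite /F/= !in_itv/=.
    by move=> /andP[ut ->]; rewrite andbT (lt_trans (u0 n)).
  move=> /andP[t0 tx].
  have : \forall n \near \oo, u n < t.
    have := ucvg; move/cvgr_lt; apply; exact: t0.
  by case=> N _ /(_ N (leqnn N)) uN; exists N => //; rewrite /F/= in_itv/= uN tx.
have h1 : (\int[mu]_(t in F n) (t `^ c)%:E @[n --> \oo] -->
    \int[mu]_(t in `]0%R, x[) (t `^ c)%:E)%E.
  rewrite -UF; apply: ge0_nondecreasing_set_cvg_integral => //.
  - by move=> n; exact: measurable_itv.
  - by move=> n; exact: measurable_powR_EFin.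
  - by move=> n t _; rewrite lee_fin powR_ge0.
have h2 : (\int[mu]_(t in F n) (t `^ c)%:E @[n --> \oo] -->
    (x `^ (c + 1) / (c + 1))%:E)%E.
  rewrite (_ : (fun n => _) =
    EFin \o (fun n => (x `^ (c + 1) - u n `^ (c + 1)) / (c + 1))); last first.
    by apply/funext => n; rewrite integral_powR ?gt_eqF.
  apply: cvg_EFin; first by near=> n.
  apply: cvgMl; rewrite -[X in _ --> X]subr0.
  apply: cvgB; first exact: cvg_cst.
  have /cvg_at_rightP := powR_cvg0 c0; apply; split => //.
by rewrite -(cvg_lim _ h1)// (cvg_lim _ h2).
Unshelve. all: by end_near. Qed.

Lemma integral_powRy_lty (c : R) : c < -1 ->
  (\int[mu]_(t in `]1%R, +oo[) (t `^ c)%:E < +oo)%E.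
Proof.
move=> c1.
have c0 : c + 1 < 0 by rewrite -ltrBrDr sub0r.
pose F n := `]1, n.+2%:R[%classic : set R.
have ndF : nondecreasing_seq F.
  move=> m n mn; rewrite subsetEset => t; rewrite /F/= !in_itv/= => /andP[-> um].
  by rewrite (lt_le_trans um)// ler_nat !ltnS.
have UF : \bigcup_n F n = `]1, +oo[%classic.
  apply/seteqP; split => [t [n _]|t]; rewrite /F/= !in_itv/= ?andbT.
    by move=> /andP[].
  move=> t1; exists (Num.truncn t) => //; rewrite /F/= in_itv/= t1/=.
  by rewrite (lt_trans (truncnS_gt _))// ltr_nat.
have h1 : (\int[mu]_(t in F n) (t `^ c)%:E @[n --> \oo] -->
    \int[mu]_(t in `]1%R, +oo[) (t `^ c)%:E)%E.
  rewrite -UF; apply: ge0_nondecreasing_set_cvg_integral => //.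
  - by move=> n; exact: measurable_itv.
  - by move=> n; exact: measurable_powR_EFin.
  - by move=> n t _; rewrite lee_fin powR_ge0.
rewrite -(cvg_lim _ h1)//.
apply: (@le_lt_trans _ _ (- (c + 1)^-1)%:E); last exact: ltry.
apply: lime_le; first by apply/cvg_ex; exists (\int[mu]_(t in `]1%R, +oo[) (t `^ c)%:E)%E.
near=> n; rewrite integral_powR ?ltr1n ?lt_eqF// lee_fin powR1.
rewrite ler_ndivrMr// mulNr mulVf ?lt_eqF//.
by rewrite lerBrDl subrr powR_ge0.
Unshelve. all: by end_near. Qed.

End power_integrals.

(** * Minkowski's integral inequality *)

Section integral_section.
Context d1 d2 (T1 : measurableType d1) (T2 : measurableType d2) (R : realType).
Variables (m2 : {sigma_finite_measure set T2 -> \bar R}).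
Local Open Scope ereal_scope.

Lemma measurable_integral_section (S : set T2) (H : T1 * T2 -> \bar R) :
  measurable S -> measurable_fun [set: T1 * T2] H ->
  measurable_fun [set: T1] (fun x => \int[m2]_(y in S) H (x, y)).
Proof.
move=> mS mH.
have mHS (g : T1 * T2 -> \bar R) : measurable_fun setT g ->
    (forall z, 0 <= g z) ->
    measurable_fun [set: T1] (fun x => \int[m2]_(y in S) g (x, y)).
  move=> mg g0; pose gS : T1 * T2 -> \bar R := g \_ (snd @^-1` S).
  have mgS : measurable_fun setT gS.
    apply/(measurable_restrictT g) => //; last exact: measurable_funTS.
    by rewrite -[X in measurable X]setTI; exact: measurable_snd.
  have gS0 z : 0 <= gS z by apply: erestrict_ge0 => ? _.
  have := measurable_fun_fubini_tonelli_F (m2 := m2) _ mgS gS0.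
  apply: eq_measurable_fun => x _; rewrite /fubini_F [RHS]integral_mkcond.
  apply: eq_integral => y _; rewrite /gS /patch.
  by congr (if _ then _ else _); apply/idP/idP; rewrite !inE.
rewrite (_ : (fun x => _) = (fun x => \int[m2]_(y in S) H^\+ (x, y)) \-
    (fun x => \int[m2]_(y in S) H^\- (x, y))); last first.
  by apply/funext => x; rewrite integralE !unlock.
apply: emeasurable_funB; apply: mHS => //; first exact: measurable_funepos.
exact: measurable_funeneg.
Qed.

End integral_section.

Section minkowski_integral.
Context d1 d2 (T1 : measurableType d1) (T2 : measurableType d2) (R : realType).
Variables (m1 : {sigma_finite_measure set T1 -> \bar R}).
Variables (m2 : {sigma_finite_measure set T2 -> \bar R}).
Local Open Scope ereal_scope.

Lemma ge0_fubini_in (B : set T1) (S : set T2) (H : T1 * T2 -> \bar R) :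
  measurable B -> measurable S -> measurable_fun [set: T1 * T2] H ->
  (forall z, 0 <= H z) ->
  \int[m1]_(x in B) \int[m2]_(y in S) H (x, y) =
  \int[m2]_(y in S) \int[m1]_(x in B) H (x, y).
Proof.
move=> mB mS mH H0.
pose K : T1 * T2 -> \bar R := H \_ (B `*` S).
have mK : measurable_fun setT K.
  apply/(measurable_restrictT H); first exact: measurableX.
  exact: measurable_funTS.
have K0 z : 0 <= K z by apply: erestrict_ge0 => ? _.
have KE x y : K (x, y) = if (x \in B) && (y \in S) then H (x, y) else 0.
  rewrite /K /patch; congr (if _ then _ else _).
  by apply/idP/andP => [|[]]; rewrite !inE.
have := fubini_tonelli (m1 := m1) (m2 := m2) K mK K0.
have -> : \int[m1]_x \int[m2]_y K (x, y) =
    \int[m1]_(x in B) \int[m2]_(y in S) H (x, y).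
  rewrite [RHS]integral_mkcond; apply: eq_integral => x _.
  rewrite patchE; case: ifPn => xB.
    rewrite [RHS]integral_mkcond; apply: eq_integral => y _.
    by rewrite KE xB patchE.
  by rewrite integral0_eq// => y _; rewrite KE (negbTE xB).
move=> ->.
rewrite [RHS]integral_mkcond; apply: eq_integral => y _.
rewrite patchE; case: ifPn => yS.
  rewrite [RHS]integral_mkcond; apply: eq_integral => x _.
  by rewrite KE yS andbT patchE.
by rewrite integral0_eq// => x _; rewrite KE (negbTE yS) andbF.
Qed.

(** Minkowski's integral inequality, in the form needed for a superposition of
    dilates: each slice [G (_, y)] has its [p]-th power integral bounded by
    [(a y) `^ p * D]. Jensen's inequality with the density [a * w] brings the
    power [p] inside the inner integral and costs [k `^ (p - 1)]; exchanging the
    integrals then costs the remaining factor [k], so the constant is exactly the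
    one of the triangle inequality. *)
Lemma minkowski_integral (B : set T1) (S : set T2) (G : T1 * T2 -> R)
    (a w : T2 -> R) (p k D : R) :
  measurable B -> measurable S -> measurable_fun [set: T1 * T2] G ->
  measurable_fun [set: T2] a -> measurable_fun [set: T2] w ->
  (forall z, 0 <= G z)%R -> (forall y, 0 <= a y)%R -> (forall y, 0 <= w y)%R ->
  (forall y, S y -> 0 < a y)%R -> (1 <= p)%R -> (0 <= D)%R ->
  \int[m2]_(y in S) (a y * w y)%:E = k%:E ->
  (forall y, S y ->
    \int[m1]_(x in B) (G (x, y) `^ p)%:E <= ((a y) `^ p * D)%:E) ->
  \int[m1]_(x in B) (\int[m2]_(y in S) (G (x, y) * w y)%:E) `^ p <=
  (k `^ p * D)%:E.
Proof.
move=> mB mS mG ma mw G0 a0 w0 aS p1 D0 kE GD.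
have p0 : (0 < p)%R by rewrite (lt_le_trans ltr01).
have k0 : (0 <= k)%R.
  by rewrite -lee_fin -kE; apply: integral_ge0 => y _; rewrite lee_fin mulr_ge0.
have mpow d (T : measurableType d) (h : T -> R) c : measurable_fun setT h ->
    measurable_fun setT (fun x => h x `^ c)%R.
  by move=> mh; exact: (measurableT_comp (measurable_powR c)).
have msnd (h : T2 -> R) : measurable_fun setT h ->
    measurable_fun setT (fun z : T1 * T2 => h z.2).
  by move=> mh; exact: (measurableT_comp mh measurable_snd).
pose c y := (a y `^ (- p) * (a y * w y))%R.
have c0 y : (0 <= c y)%R by rewrite !mulr_ge0// powR_ge0.
have mc : measurable_fun setT c.
  by apply: measurable_funM; [exact: mpow|exact: measurable_funM].
pose H (z : T1 * T2) := (G z `^ p * c z.2)%:E.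
have mH : measurable_fun setT H.
  apply/measurable_EFinP; apply: measurable_funM; first exact: mpow.
  exact: msnd.
have H0 z : 0 <= H z by rewrite lee_fin mulr_ge0// powR_ge0.
have key x : (\int[m2]_(y in S) (G (x, y) * w y)%:E) `^ p <=
    (k `^ (p - 1))%:E * \int[m2]_(y in S) H (x, y).
  have mGx : measurable_fun setT (fun y => G (x, y)).
    exact: (measurableT_comp mG (pair1_measurable x)).
  pose u y := (G (x, y) * a y `^ (- 1))%R.
  have := @weighted_power_mean _ _ _ m2 S u (fun y => a y * w y)%R p mS.
  rewrite kE poweR_EFin => W; apply: (le_trans _ (le_trans (W _ _ _ _ _) _)).
  - rewrite le_eqVlt; apply/orP; left; apply/eqP; congr (_ `^ _).
    apply: eq_integral => y; rewrite inE => Sy; congr EFin.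
    rewrite /u powR_inv1 ?a0// -mulrA; congr (_ * _)%R.
    by rewrite mulKf// gt_eqF// aS.
  - apply: measurable_funTS; apply: measurable_funM => //; exact: mpow.
  - by apply: measurable_funTS; apply: measurable_funM.
  - by move=> y Sy; rewrite mulr_ge0// powR_ge0.
  - by move=> y Sy; rewrite mulr_ge0.
  - exact: p1.
  - rewrite le_eqVlt; apply/orP; left; apply/eqP; congr (_ * _).
    apply: eq_integral => y; rewrite inE => Sy; congr EFin.
    by rewrite /u powRM ?powR_ge0// -powRrM mulN1r /c/= !mulrA.
have mI : measurable_fun [set: T1] (fun x => \int[m2]_(y in S) H (x, y)).
  exact: measurable_integral_section.
apply: (@le_trans _ _
  (\int[m1]_(x in B) ((k `^ (p - 1))%:E * \int[m2]_(y in S) H (x, y)))).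
  apply: ge0_le_integral => //.
  - by move=> x _; exact: poweR_ge0.
  - apply: (@measurableT_comp _ _ _ _ _ _ (fun z : \bar R => z `^ p)).
      exact: measurable_poweR.
    apply: measurable_funTS.
    apply: (@measurable_integral_section _ _ _ _ _ m2 S
      (fun z => (G z * w z.2)%:E)) => //.
    apply/measurable_EFinP; apply: measurable_funM => //; exact: msnd.
  - by apply: measurable_funeM; exact: measurable_funTS.
rewrite ge0_integralZl//; last 3 first.
- exact: measurable_funTS.
- by move=> x _; exact: integral_ge0.
- by rewrite lee_fin powR_ge0.
rewrite ge0_fubini_in//.
apply: (@le_trans _ _ ((k `^ (p - 1))%:E *
    \int[m2]_(y in S) (D%:E * (a y * w y)%:E))).
  rewrite lee_wpmul2l ?lee_fin ?powR_ge0//.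
  apply: ge0_le_integral => //.
  - by move=> y _; exact: integral_ge0.
  - apply: measurable_funTS.
    apply: (@measurable_integral_section _ _ _ _ _ m1 B (fun z => H (z.2, z.1))) => //.
    apply: (measurableT_comp mH).
    by apply: measurable_fun_pair; [exact: measurable_snd|exact: measurable_fst].
  - apply: measurable_funeM; apply: measurable_funTS; apply/measurable_EFinP.
    exact: measurable_funM.
  - move=> y Sy.
    under eq_integral do rewrite /H /= EFinM.
    rewrite ge0_integralZr//; last 3 first.
    + apply/measurable_EFinP/measurable_funTS/mpow.
      exact: (measurableT_comp mG (pair2_measurable y)).
    + by move=> x _; rewrite lee_fin powR_ge0.
    + by rewrite lee_fin.
    apply: (@le_trans _ _ ((a y `^ p * D)%:E * (c y)%:E)).
      by rewrite lee_wpmul2r ?lee_fin// GD.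
    rewrite -!EFinM lee_fin /c powRN mulrACA divff ?mul1r//.
    by rewrite gt_eqF// powR_gt0// aS.
rewrite ge0_integralZl//; last 2 first.
- by apply/measurable_EFinP/measurable_funTS; exact: measurable_funM.
- by move=> y _; rewrite lee_fin mulr_ge0.
rewrite kE -!EFinM lee_fin -(mulr_powRB1 k0 p0).
by rewrite (mulrC D) mulrA (mulrC k).
Qed.

End minkowski_integral.

(** * The Morrey norm on a segment *)

Section morrey_segment.
Context {R : realType}.
Implicit Types (l : \bar R) (p lambda b x y r s : R) (f : R -> R).
Local Notation mu := (@lebesgue_measure R).

Definition open_segment0 l : set R := [set t | (0 < t%:E < l)%E].

Definition window l x r : set R := [set y | segment0 l y /\ `|y - x| < r].

Lemma measurable_segment0 l : measurable (segment0 l).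
Proof.
rewrite (_ : segment0 l = EFin @^-1` [set` `[0%E, l]]).
  by rewrite -[X in measurable X]setTI; apply: EFin_measurable => //;
    exact: emeasurable_itv.
by apply/seteqP; split => t; rewrite /segment0/= in_itv.
Qed.

Lemma measurable_gt_lt x l : measurable [set t : R | (x%:E < t%:E < l)%E].
Proof.
rewrite (_ : [set t | _] = EFin @^-1` [set` `]x%:E, l[]).
  by rewrite -[X in measurable X]setTI; apply: EFin_measurable => //;
    exact: emeasurable_itv.
by apply/seteqP; split => t/=; rewrite in_itv.
Qed.

Lemma measurable_open_segment0 l : measurable (open_segment0 l).
Proof. exact: measurable_gt_lt. Qed.

Lemma open_segment0_sub l : open_segment0 l `<=` segment0 l.
Proof. by move=> t /andP[/ltW t0 /ltW tl]; rewrite /segment0/= t0. Qed.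

Lemma window_ball l x r : window l x r = segment0 l `&` ball x r.
Proof.
by apply/seteqP; split => y; rewrite /ball/= distrC.
Qed.

Lemma measurable_window l x r : measurable (window l x r).
Proof.
rewrite window_ball; apply: measurableI; first exact: measurable_segment0.
exact: measurable_ball.
Qed.

Lemma window_sub l x r : window l x r `<=` segment0 l.
Proof. by move=> y []. Qed.

Lemma measurable_norm_powR (D : set R) f p : measurable_fun D f ->
  measurable_fun D (fun y => (`|f y| `^ p)%:E).
Proof.
move=> mf; apply/measurable_EFinP.
apply: (@measurableT_comp _ _ _ _ _ _ (fun z : R => z `^ p)).
  exact: measurable_powR.
exact: measurableT_comp.
Qed.

(** Clearing the root and the normalisation, which makes the estimates below
    statements about integrals over windows. *)
Lemma morrey_norm_leP l p lambda f (M : R) : 0 < p -> 0 <= M ->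
  (morrey_norm p lambda (segment0 l) f <= M%:E)%E <->
  forall x r, segment0 l x -> 0 < r ->
    (\int[mu]_(y in window l x r) (`|f y| `^ p)%:E <= (r `^ lambda * M `^ p)%:E)%E.
Proof.
move=> p0 M0.
have pK : p^-1 * p = 1 by rewrite mulVf// gt_eqF.
have I0 x r : (0 <= \int[mu]_(y in window l x r) (`|f y| `^ p)%:E)%E.
  by apply: integral_ge0 => y _; rewrite lee_fin powR_ge0.
have equiv x r : 0 < r ->
  ((((r `^ lambda)^-1)%:E * \int[mu]_(y in window l x r) (`|f y| `^ p)%:E)
     `^ p^-1 <= M%:E)%E =
  (\int[mu]_(y in window l x r) (`|f y| `^ p)%:E <= (r `^ lambda * M `^ p)%:E)%E.
  move=> r0; have rl : 0 < r `^ lambda by rewrite powR_gt0.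
  set I := (\int[mu]_(y in _) _)%E.
  have rI0 : (0 <= ((r `^ lambda)^-1)%:E * I)%E.
    by apply: mule_ge0; [rewrite lee_fin invr_ge0 ltW|exact: I0].
  rewrite EFinM -lee_pdivrMl// -poweR_EFin.
  apply/idP/idP => h.
    rewrite -[leLHS](poweRe1 rI0) -pK poweRrM.
    apply: (gt0_ler_poweR (ltW p0)) h; rewrite in_itv/= leey ?andbT ?lee_fin//.
    exact: poweR_ge0.
  have -> : (M%:E = (M%:E `^ p) `^ p^-1)%E.
    by rewrite -poweRrM mulrC pK poweRe1// lee_fin.
  apply: gt0_ler_poweR h; first by rewrite invr_ge0 ltW.
    by rewrite in_itv/= leey andbT.
  by rewrite in_itv/= leey andbT lee_fin powR_ge0.
split=> [h x r Ex r0|h].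
  rewrite -equiv//; apply: le_trans h; apply: ereal_sup_ubound.
  by exists x, r; split.
by apply: ge_ereal_sup => _ [x [r [Ex r0 ->]]]; rewrite equiv//; exact: h.
Qed.

Lemma morrey_norm_ge0 l p lambda f : (0 <= l)%E ->
  (0 <= morrey_norm p lambda (segment0 l) f)%E.
Proof.
move=> l0; set z := (X in (_ <= X)%E).
pose v := ((((1 `^ lambda)^-1)%:E * \int[mu]_(y in window l 0 1) (`|f y| `^ p)%:E)
     `^ p^-1)%E.
apply: (@le_trans _ _ v); first exact: poweR_ge0.
by apply: ereal_sup_ubound; exists 0, 1; split => //; rewrite /segment0/= lexx.
Qed.

(** When [x * s] falls beyond [l], the window around it is contained in the one
    of the same radius around the endpoint [l]. *)
Lemma window_dilation l x r s : (0 <= l)%E -> 0 < s -> segment0 l x ->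
  exists2 x', segment0 l x' &
    forall y, `|y - x| < r -> open_segment0 l (y * s) ->
      window l x' (s * r) (y * s).
Proof.
move=> l0 s0 /andP[x0 xl].
have near_xs z : `|z - x| < r -> `|z * s - x * s| < s * r.
  by rewrite -mulrBl normrM (gtr0_norm s0) mulrC ltr_pM2l.
have xs0 : 0 <= x * s by apply: mulr_ge0 => //; exact: ltW.
have [xsl|lxs] := leP (x * s)%:E l.
  exists (x * s); first by rewrite /segment0/= xsl lee_fin xs0.
  by move=> z zx zs; split; [exact: open_segment0_sub|exact: near_xs].
case: l l0 xl lxs => [l||]// l0 xl; rewrite lte_fin => lxs.
exists l; first by rewrite /segment0/= l0 lexx.
move=> z zx zs; split; first exact: open_segment0_sub.
move: zs => /andP[_]; rewrite lte_fin => zl.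
apply: le_lt_trans (near_xs _ zx).
rewrite !ltr0_norm ?subr_lt0//; first by lra.
exact: lt_trans lxs.
Qed.

Lemma measurable_restrict_segment l f : measurable_fun (segment0 l) f ->
  measurable_fun [set: R] (f \_ (open_segment0 l)).
Proof.
move=> mf; apply/(measurable_restrictT f); first exact: measurable_open_segment0.
apply: measurable_funS mf; [exact: measurable_segment0|exact: open_segment0_sub].
Qed.

(** Dilating [f] by [s] multiplies the Morrey norm by at most
    [s `^ ((lambda - 1) / p)]: the substitution contributes [s^-1] and the
    dilated radius contributes [s `^ lambda]. This exponent is the one that
    decides the boundedness of the Hardy operators. *)
Lemma integral_dilation_window l p lambda f (M : R) x r s : (0 <= l)%E ->
  0 < p -> 0 <= M -> measurable_fun (segment0 l) f ->
  (morrey_norm p lambda (segment0 l) f <= M%:E)%E ->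
  segment0 l x -> 0 < r -> 0 < s ->
  (\int[mu]_(y in window l x r)
      (`|(f \_ (open_segment0 l)) (y * s)%R| `^ p)%:E
   <= ((s `^ ((lambda - 1) / p)) `^ p * (r `^ lambda * M `^ p))%:E)%E.
Proof.
move=> l0 p0 M0 mf /(morrey_norm_leP l lambda f p0 M0) fM Ex r0 s0.
have [x' Ex' sub] := @window_dilation l x r s l0 s0 Ex.
pose h : R -> \bar R := (fun y => (`|f y| `^ p)%:E) \_ (window l x' (s * r)).
have mfp : measurable_fun (window l x' (s * r)) (fun y => (`|f y| `^ p)%:E).
  apply: measurable_norm_powR; apply: measurable_funS mf; last exact: window_sub.
  exact: measurable_segment0.
have mh : measurable_fun setT h.
  by apply/(measurable_restrictT _ (measurable_window l x' (s * r))).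
have h0 t : (0 <= h t)%E.
  by apply: erestrict_ge0 => ? _; rewrite lee_fin powR_ge0.
have m1 : measurable_fun setT
    (fun y => (`|(f \_ (open_segment0 l)) (y * s)%R| `^ p)%:E).
  apply: measurable_norm_powR.
  apply: (measurableT_comp (measurable_restrict_segment mf)).
  exact: mulrr_measurable.
apply: (@le_trans _ _ (\int[mu]_y (1%:E * h (s * y)%R))%E).
  rewrite integral_mkcond; apply: ge0_le_integral => //.
  - by move=> y _; apply: erestrict_ge0 => ? _; rewrite lee_fin powR_ge0.
  - apply/(measurable_restrictT _ (measurable_window l x r)).
    exact: measurable_funTS.
  - apply: measurable_funeM; apply: (measurableT_comp mh).
    exact: mulrl_measurable.
  - move=> y _; rewrite mul1e patchE; case: ifPn => [|_]; last exact: h0.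
    rewrite inE => -[_ yx]; rewrite patchE; case: ifPn => [|_]; last first.
      by rewrite normr0 powR0 ?gt_eqF.
    by rewrite inE => /(sub _ yx) Wy; rewrite (mulrC s y) /h patchE mem_set.
rewrite ge0_integral_dilation// -integral_mkcond.
apply: (@le_trans _ _ ((1 / s)%:E * ((s * r) `^ lambda * M `^ p)%:E)%E).
  apply: lee_wpmul2l; first by rewrite lee_fin divr_ge0// ltW.
  by apply: fM => //; exact: mulr_gt0.
rewrite -EFinM lee_fin -powRrM divfK ?gt_eqF// powRM ?(ltW s0) ?(ltW r0)//.
rewrite powRB; last by apply/implyP => _; rewrite gt_eqF.
by rewrite powRr1 ?(ltW s0)// div1r !mulrA (mulrC s^-1).
Qed.

(** The Hardy operators after the substitution [t = y * s], which turns them into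
    superpositions of dilates of [F]: [S] is [`]0, 1[] for the operator that
    integrates from the origin and [`]1, +oo[] for its dual. *)
Definition average (S : set R) b (F : R -> R) (y : R) : \bar R :=
  (\int[mu]_(s in S) (F (y * s) * s `^ (- b))%:E)%E.

Lemma average_morrey l p lambda b (S : set R) f (M k : R) x r :
  (0 <= l)%E -> 1 <= p -> 0 <= M -> measurable_fun (segment0 l) f ->
  (morrey_norm p lambda (segment0 l) f <= M%:E)%E ->
  measurable S -> (forall s, S s -> 0 < s) ->
  (\int[mu]_(s in S) (s `^ ((lambda - 1) / p - b))%:E = k%:E)%E ->
  segment0 l x -> 0 < r ->
  (\int[mu]_(y in window l x r)
     (average S b (Num.norm \o (f \_ (open_segment0 l))) y) `^ p
   <= (k `^ p * (r `^ lambda * M `^ p))%:E)%E.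
Proof.
move=> l0 p1 M0 mf fM mS S0 kE Ex r0.
have p0 : 0 < p by rewrite (lt_le_trans ltr01).
have mF := measurable_restrict_segment mf.
apply: (@minkowski_integral _ _ _ _ _ mu mu (window l x r) S
  (fun z => `|(f \_ (open_segment0 l)) (z.1 * z.2)|)
  (fun s => s `^ ((lambda - 1) / p)) (fun s => s `^ (- b))) => //.
- exact: measurable_window.
- apply: (@measurableT_comp _ _ _ _ _ _ (Num.norm \o (f \_ (open_segment0 l)))).
    exact: measurableT_comp.
  apply: (@measurable_funM _ _ R setT fst snd).
    exact: (@measurable_fst _ _ (measurableTypeR R) (measurableTypeR R)).
  exact: (@measurable_snd _ _ (measurableTypeR R) (measurableTypeR R)).
- by move=> y; rewrite powR_ge0.
- by move=> y; rewrite powR_ge0.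
- by move=> s /S0 s0; rewrite powR_gt0.
- by rewrite mulr_ge0// powR_ge0.
- rewrite -kE; apply: eq_integral => s; rewrite inE => /S0 s0.
  by rewrite -powRD//; apply/implyP => _; rewrite gt_eqF.
- by move=> s /S0 s0; exact: integral_dilation_window.
Qed.

End morrey_segment.

(** * Boundedness of superpositions of dilations *)

Section sufficiency.
Context {R : realType}.
Implicit Types (l : \bar R) (p lambda b x y r s : R) (f : R -> R).
Local Notation mu := (@lebesgue_measure R).

Definition kernel_support (S : set R) l y : set R :=
  [set t | open_segment0 l t /\ S (t / y)].

(** Common form of the two Hardy operators. *)
Definition kernel_operator (S : set R) l b f y : R :=
  y `^ (b - 1) * \int[mu]_(t in kernel_support S l y) (f t / t `^ b).

Lemma measurable_kernel_support S l y : measurable S ->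
  measurable (kernel_support S l y).
Proof.
move=> mS; apply: measurableI; first exact: measurable_open_segment0.
have mm : measurable_fun setT (fun t : R => t * y^-1) by exact: mulrr_measurable.
by rewrite -[X in measurable X]setTI; exact: mm.
Qed.

Lemma measurable_div_powR l f b (D : set R) : measurable D ->
  D `<=` segment0 l -> measurable_fun (segment0 l) f ->
  measurable_fun D (fun t => (f t / t `^ b)%:E).
Proof.
move=> mD DE mf; apply/measurable_EFinP.
apply: measurable_funM.
  by apply: measurable_funS mf => //; exact: measurable_segment0.
rewrite (_ : (fun t => _) = (fun t : R => t `^ (- b))).
  by apply: measurable_funTS; exact: measurable_powR.
by apply/funext => t; rewrite powRN.
Qed.

(** The substitution [t = y * s]; outside [open_segment0 l] the function [f] is
    replaced by [0], so that the domain of integration no longer depends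
    on [y]. *)
Lemma integral_kernel_support S l b f y : measurable S ->
  (forall s, S s -> 0 < s) -> measurable_fun (segment0 l) f -> 0 < y ->
  (\int[mu]_(t in kernel_support S l y) (f t / t `^ b)%:E =
   (y `^ (1 - b))%:E * average S b (f \_ (open_segment0 l)) y)%E.
Proof.
move=> mS S0 mf y0.
pose h : R -> \bar R := (fun t => (f t / t `^ b)%:E) \_ (kernel_support S l y).
have mD := measurable_kernel_support l y mS.
have mh : measurable_fun setT h.
  apply/(measurable_restrictT _ mD); apply: measurable_div_powR mf => //.
  by move=> t [/open_segment0_sub].
have -> : average S b (f \_ (open_segment0 l)) y =
    (\int[mu]_s ((y `^ b)%:E * h (y * s)%R))%E.
  rewrite /average integral_mkcond; apply: eq_integral => s _.
  rewrite [LHS]patchE /h [in RHS]patchE.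
  have yK : y * s / y = s by rewrite mulrAC divff ?mul1r ?gt_eqF.
  case: ifPn => [|sS]; last first.
    rewrite memNset ?mule0// => -[_]; rewrite yK => Ss.
    by move/negP : sS; apply; rewrite inE.
  rewrite inE => Ss; rewrite patchE; case: ifPn => yI; last first.
    rewrite memNset ?mule0 ?mul0r// => -[yI' _].
    by move/negP : yI; apply; rewrite inE.
  rewrite mem_set; last by split; [exact/set_mem|rewrite yK].
  rewrite -EFinM; congr EFin.
  rewrite powRM ?(ltW y0) ?(ltW (S0 _ Ss))// invfM powRN mulrCA; congr (_ * _).
  by rewrite mulrA divff ?mul1r// gt_eqF// powR_gt0.
rewrite integral_dilation ?powR_gt0// -integral_mkcond muleA -EFinM.
rewrite -[y in _ / y](powRr1 (ltW y0)) mulrA -powRD; last first.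
  by apply/implyP => _; rewrite gt_eqF.
by rewrite subrK divff ?mul1e// powRr1 ?gt_eqF// ltW.
Qed.

Lemma measurable_average l S b f : measurable S ->
  measurable_fun (segment0 l) f ->
  measurable_fun [set: R] (average S b (f \_ (open_segment0 l))).
Proof.
move=> mS mf.
pose H (z : R * R) := ((f \_ (open_segment0 l)) (z.1 * z.2) * z.2 `^ (- b))%:E.
suff mH : measurable_fun [set: measurableTypeR R * measurableTypeR R] H.
  exact: (@measurable_integral_section _ _ (measurableTypeR R)
    (measurableTypeR R) _ mu S H mS mH).
apply/measurable_EFinP; apply: measurable_funM.
  apply: (measurableT_comp (measurable_restrict_segment mf)).
  apply: (@measurable_funM _ _ R setT fst snd).
    exact: (@measurable_fst _ _ (measurableTypeR R) (measurableTypeR R)).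
  exact: (@measurable_snd _ _ (measurableTypeR R) (measurableTypeR R)).
apply: (measurableT_comp (measurable_powR _)).
exact: (@measurable_snd _ _ (measurableTypeR R) (measurableTypeR R)).
Qed.

Lemma abse_average_le S b (F : R -> R) y : measurable S ->
  measurable_fun [set: R] F ->
  (`|average S b F y| <= average S b (Num.norm \o F) y)%E.
Proof.
move=> mS mF; rewrite /average.
have mi : measurable_fun S (fun s => (F (y * s) * s `^ (- b))%:E).
  apply/measurable_EFinP; apply: measurable_funTS; apply: measurable_funM.
    by apply: (measurableT_comp mF); exact: mulrl_measurable.
  exact: measurable_powR.
apply: (le_trans (le_abse_integral mu mS mi)).
rewrite le_eqVlt; apply/orP; left; apply/eqP; apply: eq_integral => s _ /=.
by rewrite normrM (ger0_norm (powR_ge0 _ _)).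
Qed.

Lemma average_ge0 S b (F : R -> R) y : (forall t, 0 <= F t) ->
  (0 <= average S b F y)%E.
Proof.
by move=> F0; apply: integral_ge0 => s _; rewrite lee_fin mulr_ge0// powR_ge0.
Qed.

Lemma window_open_segment l u v : u < v ->
  `]u, v[ `<=` open_segment0 l -> window l ((u + v) / 2) ((v - u) / 2) = `]u, v[%classic.
Proof.
move=> uv sub; rewrite window_ball; apply/seteqP; split => y.
  by move=> [_]; rewrite /ball/= in_itv/= ltr_norml => /andP[? ?]; lra.
move=> yuv; split; first by apply: open_segment0_sub; exact: sub.
by move: yuv; rewrite /ball/= in_itv/= ltr_norml => /andP[? ?]; lra.
Qed.

Variables (l : \bar R) (p lambda b k : R) (S : set R).
Variables (T : (R -> R) -> R -> R) (defined : (R -> R) -> Prop).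
Hypotheses (l0 : (0 < l)%E) (p1 : 1 <= p).
Hypotheses (mS : measurable S) (S0 : forall s, S s -> 0 < s).
Hypothesis TE : forall f y, segment0 l y -> 0 < y ->
  T f y = kernel_operator S l b f y.
Hypothesis definedE : forall f, (forall y, open_segment0 l y ->
  mu.-integrable (kernel_support S l y) (fun t => (f t / t `^ b)%:E)) -> defined f.
Hypothesis kernel_monotone : forall y, open_segment0 l y -> exists u v,
  [/\ u < v, `]u, v[ `<=` open_segment0 l &
    forall z, z \in `]u, v[ -> kernel_support S l y `<=` kernel_support S l z].
Hypothesis kE :
  (\int[mu]_(s in S) (s `^ ((lambda - 1) / p - b))%:E = k%:E)%E.

Let p0 : 0 < p. Proof. by rewrite (lt_le_trans ltr01). Qed.

Let k0 : 0 <= k.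
Proof.
by rewrite -lee_fin -kE; apply: integral_ge0 => s _; rewrite lee_fin powR_ge0.
Qed.

Let I := open_segment0 l.

Lemma operator_average f y : measurable_fun (segment0 l) f ->
  segment0 l y -> 0 < y -> T f y = fine (average S b (f \_ I) y).
Proof.
move=> mf Ey y0; rewrite TE// /kernel_operator /Rintegral.
rewrite integral_kernel_support//.
have y1 : y `^ (b - 1) * y `^ (1 - b) = 1.
  rewrite -powRD; last by apply/implyP => _; rewrite gt_eqF.
  by rewrite (_ : b - 1 + (1 - b) = 0) ?powRr0//; ring.
case: (average _ _ _ _) => [a||]/=.
- by rewrite mulrA y1 mul1r.
- by rewrite gt0_muley ?lte_fin ?powR_gt0//= mulr0.
- by rewrite gt0_muleNy ?lte_fin ?powR_gt0//= mulr0.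
Qed.

Lemma operator_measurable f : measurable_fun (segment0 l) f ->
  measurable_fun (segment0 l) (T f).
Proof.
move=> mf.
pose g y := if 0 < y then fine (average S b (f \_ I) y) else T f 0.
apply: (@eq_measurable_fun _ _ _ _ _ g).
  move=> y; rewrite inE => Ey; rewrite /g; case: ifPn => [y0|].
    by rewrite operator_average.
  rewrite -leNgt => y0; congr (T f _); apply/eqP; rewrite eq_le y0 andbT.
  by case/andP : Ey.
apply: measurable_funTS; apply: measurable_fun_ifT => //.
  exact: measurable_fun_ltr.
by apply: measurableT_comp => //; exact: measurable_average.
Qed.

(** The pointwise comparison with the average may fail at the origin, where the
    definition of a Hardy operator can produce a spurious nonzero value: for the
    dual operator the factor [0 `^ 0] is [1]. *)
Lemma operator_bound f (M : R) : 0 <= M -> measurable_fun (segment0 l) f ->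
  (morrey_norm p lambda (segment0 l) f <= M%:E)%E ->
  (morrey_norm p lambda (segment0 l) (T f) <= (k * M)%:E)%E.
Proof.
move=> M0 mf fM; apply/morrey_norm_leP => //; first exact: mulr_ge0.
move=> x r Ex r0.
have le_l0 := ltW l0.
have := average_morrey le_l0 p1 M0 mf fM mS S0 kE Ex r0.
rewrite powRM// mulrCA; apply: le_trans.
have mA : measurable_fun [set: R] (average S b (Num.norm \o (f \_ I))).
  rewrite (_ : Num.norm \o _ = (Num.norm \o f) \_ I).
    by apply: measurable_average => //; exact: measurableT_comp.
  by apply/funext => t; rewrite /= !patchE; case: ifPn => //; rewrite normr0.
have mI := measurable_window l x r.
apply: ae_ge0_le_integral => //.
- apply: measurable_norm_powR; apply: measurable_funS (operator_measurable mf).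
    exact: measurable_segment0.
  exact: window_sub.
- by move=> y _; rewrite poweR_ge0.
- apply: (@measurableT_comp _ _ _ _ _ _ (fun z : \bar R => z `^ p)%E).
    exact: measurable_poweR.
  exact: measurable_funTS.
exists [set 0]; split; first exact: measurable_set1.
  exact: lebesgue_measure_set1.
move=> y /= /not_implyP[[Ey _] h]; apply: contrapT => /eqP yN0; apply: h.
have y0 : 0 < y by rewrite lt_def yN0; case/andP : Ey.
rewrite -poweR_EFin operator_average//.
apply: gt0_ler_poweR; first exact: ltW.
- by rewrite in_itv/= leey andbT lee_fin normr_ge0.
- rewrite in_itv/= leey andbT; apply: average_ge0 => t; exact: normr_ge0.
apply: le_trans (abse_average_le _ _ mS (measurable_restrict_segment mf)).
have abs_fine (z : \bar R) : (`|fine z|%:E <= `|z|)%E.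
  by case: z => [a||]//=; rewrite leey.
exact: abs_fine.
Qed.

(** By the norm estimate the averages of [|f|] are finite almost everywhere.
    Since the domains of integration are nested, finiteness at some point of the
    interval provided by [kernel_monotone] gives integrability at [y] itself. *)
Lemma operator_defined f : morrey p lambda (segment0 l) f -> defined f.
Proof.
move=> [mf fM]; apply: definedE => y Iy.
have [u [v [uv uvI uvy]]] := kernel_monotone Iy.
have le_l0 := ltW l0.
have N0 := morrey_norm_ge0 p lambda f le_l0.
pose M := fine (morrey_norm p lambda (segment0 l) f).
have ME : M%:E = morrey_norm p lambda (segment0 l) f.
  by rewrite fineK// ge0_fin_numE.
have M0 : 0 <= M by rewrite -lee_fin ME.
have fleM : (morrey_norm p lambda (segment0 l) f <= M%:E)%E by rewrite ME.
pose A := average S b (Num.norm \o (f \_ I)).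
have [z zuv Az] : exists2 z, z \in `]u, v[ & (A z < +oo)%E.
  apply: contrapT => noz.
  have r0 : 0 < (v - u) / 2 by rewrite divr_gt0// subr_gt0.
  have Ex : segment0 l ((u + v) / 2).
    by apply: open_segment0_sub; apply: uvI; rewrite /= in_itv/=; lra.
  (* Otherwise an infinite constant would have a finite integral over the window. *)
  have := average_morrey le_l0 p1 M0 mf fleM mS S0 kE Ex r0.
  rewrite window_open_segment// leNgt => /negP; apply.
  rewrite (@eq_integral _ _ _ _ _ (cst +oo%E)); last first.
    move=> z; rewrite inE/= => zuv.
    have -> : average S b (Num.norm \o (f \_ (open_segment0 l))) z = +oo%E.
      apply/eqP; rewrite -leye_eq leNgt; apply/negP => Az.
      by apply: noz; exists z.
    by rewrite poweRyr// gt_eqF.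
  rewrite integral_cst//= lebesgue_measure_itv/= lte_fin uv -EFinB.
  by rewrite gt0_mulye ?ltry// lte_fin subr_gt0.
have Iz : I z by exact: uvI.
have z0 : 0 < z by case/andP : Iz.
have mf' : measurable_fun (segment0 l) (Num.norm \o f) by exact: measurableT_comp.
have sub z' : kernel_support S l z' `<=` segment0 l.
  by move=> t [/open_segment0_sub].
apply/integrableP; split.
  by apply: measurable_div_powR mf => //; exact: measurable_kernel_support.
rewrite (@eq_integral _ (measurableTypeR R) R mu _
  (fun t => (`|f t| / t `^ b)%:E)); last first.
  by move=> t _ /=; rewrite normrM normfV (ger0_norm (powR_ge0 _ _)).
apply: (@le_lt_trans _ _
  (\int[mu]_(t in kernel_support S l z) (`|f t| / t `^ b)%:E)%E).
  apply: ge0_subset_integral; try exact: measurable_kernel_support.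
  - by apply: measurable_div_powR mf' => //; exact: measurable_kernel_support.
  - by move=> t _; rewrite lee_fin divr_ge0// powR_ge0.
  - exact: uvy.
rewrite (integral_kernel_support b mS S0 mf' z0).
have -> : (Num.norm \o f) \_ (open_segment0 l) = Num.norm \o (f \_ I).
  by apply/funext => t; rewrite /= !patchE; case: ifPn => //; rewrite normr0.
by apply: lte_mul_pinfty => //; rewrite lee_fin powR_ge0.
Qed.

Lemma operator_bounded : morrey_bounded p lambda (segment0 l) defined T.
Proof.
have fin f : morrey p lambda (segment0 l) f -> exists2 M, 0 <= M &
    morrey_norm p lambda (segment0 l) f = M%:E.
  move=> [mf fM]; have N0 := morrey_norm_ge0 p lambda f (ltW l0).
  exists (fine (morrey_norm p lambda (segment0 l) f)); first by rewrite fine_ge0.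
  by rewrite fineK// ge0_fin_numE.
have bound f : morrey p lambda (segment0 l) f ->
    (morrey_norm p lambda (segment0 l) (T f) <=
     k%:E * morrey_norm p lambda (segment0 l) f)%E.
  move=> Mf; have [M M0 ME] := fin _ Mf; rewrite ME -EFinM.
  by apply: operator_bound => //; [case: Mf|rewrite ME].
split; last by exists k.
move=> f Mf; split; first exact: operator_defined.
split; first by apply: operator_measurable; case: Mf.
apply: le_lt_trans (bound _ Mf) _; have [M M0 ->] := fin _ Mf.
by rewrite -EFinM ltry.
Qed.

End sufficiency.

(** * Truncated powers as test functions *)

Section necessity.
Context {R : realType}.
Implicit Types (l : \bar R) (p lambda b c x y r s : R) (f g : R -> R).
Local Notation mu := (@lebesgue_measure R).

Definition truncated_power a c : R -> R := (fun t => t `^ c) \_ `]0, a[.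

Lemma truncated_powerE a c t : 0 < t -> t < a -> truncated_power a c t = t `^ c.
Proof. by move=> t0 ta; rewrite /truncated_power patchE mem_set//= in_itv/= t0. Qed.

Lemma truncated_power_ge0 a c t : 0 <= truncated_power a c t.
Proof. by rewrite /truncated_power patchE; case: ifPn => // _; exact: powR_ge0. Qed.

Lemma measurable_truncated_power a c (D : set R) :
  measurable_fun D (truncated_power a c).
Proof.
apply: measurable_funTS; apply/(measurable_restrictT _ (measurable_itv _)).
by apply: measurable_funTS; exact: measurable_powR.
Qed.

Lemma truncated_power_powR a c p t : p != 0 ->
  `|truncated_power a c t| `^ p = truncated_power a (c * p) t.
Proof.
move=> p0; rewrite ger0_norm ?truncated_power_ge0// /truncated_power !patchE.
by case: ifPn => _; rewrite ?powR0// powRrM.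
Qed.

Lemma integral_truncated_power_le (a q : R) (D : set R) : 0 < a -> -1 < q ->
  measurable D ->
  (\int[mu]_(t in D) (truncated_power a q t)%:E <=
   (a `^ (q + 1) / (q + 1))%:E)%E.
Proof.
move=> a0 q1 mD; rewrite -integral_powR0// [leRHS]integral_mkcond.
apply: (@le_trans _ _ (\int[mu]_t (truncated_power a q t)%:E)%E).
  apply: ge0_subset_integral => //.
  - by apply/measurable_EFinP; exact: measurable_truncated_power.
  - by move=> t _; rewrite lee_fin truncated_power_ge0.
by rewrite restrict_EFin.
Qed.

(** A decreasing power is at most the sum of its restriction to [`]0, r[] and of
    its value at [r]. The first term contributes at most
    [r `^ (q + 1) / (q + 1)], and the second at most [2 * r `^ (q + 1)], the
    window having length at most [2 * r]; the factor [3] comes from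
    [q + 1 <= 1]. *)
Lemma integral_truncated_power_window l (a q x r : R) : 0 < r -> -1 < q ->
  q < 0 ->
  (\int[mu]_(y in window l x r) (truncated_power a q y)%:E <=
   (3 * (r `^ (q + 1) / (q + 1)))%:E)%E.
Proof.
move=> r0 q1 q0.
have q10 : 0 < q + 1 by rewrite -ltrBlDr sub0r.
have mW := measurable_window l x r.
apply: (@le_trans _ _ (\int[mu]_(y in window l x r)
    ((truncated_power r q y)%:E + (r `^ q)%:E))%E).
  apply: ge0_le_integral => //.
  - by move=> y _; rewrite lee_fin truncated_power_ge0.
  - by apply/measurable_EFinP; exact: measurable_truncated_power.
  - apply/measurable_EFinP; apply: measurable_funD => //.
    exact: measurable_truncated_power.
  - move=> y _; rewrite -EFinD lee_fin.
    rewrite [X in X <= _]/truncated_power patchE; case: ifPn => [|_]; last first.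
      by rewrite addr_ge0 ?truncated_power_ge0 ?powR_ge0.
    rewrite inE/= in_itv/= => /andP[y0 _].
    have [yr|ry] := ltP y r; first by rewrite truncated_powerE// lerDl powR_ge0.
    rewrite ler_wpDl ?truncated_power_ge0//.
    have powN (t : R) : t `^ q = (t `^ (- q))^-1 by rewrite -powRN opprK.
    rewrite !powN lef_pV2 ?posrE ?powR_gt0//.
    by apply: ge0_ler_powR => //; rewrite ?nnegrE ?oppr_ge0 ltW.
rewrite ge0_integralD//; last 3 first.
- by move=> y _; rewrite lee_fin truncated_power_ge0.
- by apply/measurable_EFinP; exact: measurable_truncated_power.
- by move=> y _; rewrite lee_fin powR_ge0.
rewrite integral_cst//.
apply: (@le_trans _ _ ((r `^ (q + 1) / (q + 1))%:E + (r `^ q)%:E * (r *+ 2)%:E)%E).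
  apply: leeD; first exact: integral_truncated_power_le.
  apply: lee_wpmul2l; first by rewrite lee_fin powR_ge0.
  rewrite -(lebesgue_measure_ball x (ltW r0)); apply: le_measure; rewrite ?inE//.
    exact: measurable_ball.
  by rewrite window_ball; exact: subIsetr.
rewrite -EFinM -EFinD lee_fin mulrnAr mulr2n.
have -> : r `^ q * r = r `^ (q + 1).
  rewrite powRD ?powRr1 ?ltW//; apply/implyP => _; exact: lt0r_neq0.
have : r `^ (q + 1) <= r `^ (q + 1) / (q + 1).
  by rewrite ler_pdivlMr// ler_piMr ?powR_ge0//; lra.
by lra.
Qed.

Variables (l : \bar R) (p lambda a : R).
Hypotheses (p1 : 1 <= p) (lambda01 : 0 <= lambda < 1).
Hypotheses (a0 : 0 < a) (a1 : a <= 1) (al : (a%:E < l)%E).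

Let p0 : 0 < p. Proof. by rewrite (lt_le_trans ltr01). Qed.
Let gamma := (lambda - 1) / p.
Let E := segment0 l.

Section epsilon.
Variable e : R.
Hypotheses (e0 : 0 < e) (ep : e * p < 1 - lambda).

(* The exponent of the [p]-th power of the test function. *)
Let q := lambda + e * p - 1.
Let f := truncated_power a (gamma + e).

Let gammaE : (gamma + e) * p = q.
Proof. by rewrite mulrDl /gamma divfK ?gt_eqF// /q; lra. Qed.

Let ep0 : 0 < e * p. Proof. exact: mulr_gt0. Qed.

Let q1E : q + 1 = lambda + e * p. Proof. by rewrite /q subrK. Qed.

Let q10 : 0 < q + 1.
Proof. by rewrite q1E; case/andP : lambda01 => *; move: ep0; lra. Qed.

(** Windows of radius less than [1] fall under the previous estimate, as
    [q + 1] is at least [lambda]; for larger ones the total integral is bounded,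
    while [r `^ lambda] is at least [1]. *)
Lemma truncated_power_morrey :
  (morrey_norm p lambda E f <= ((3 / (q + 1)) `^ p^-1)%:E)%E.
Proof.
have M0 : 0 <= 3 / (q + 1) by rewrite divr_ge0// ltW.
apply/morrey_norm_leP => //; first exact: powR_ge0.
move=> x r Ex r0.
rewrite -powRrM mulVf ?gt_eqF// powRr1//.
under eq_integral do rewrite truncated_power_powR ?gt_eqF// gammaE.
have [rlt1|r1] := ltP r 1.
  apply: (le_trans (integral_truncated_power_window l a x r0 _ _)).
  - by move: q10; lra.
  - by move: ep; rewrite /q; lra.
  rewrite lee_fin [leRHS]mulrCA ler_pM2l// ler_pM2r ?invr_gt0//.
  by apply: ger_powR; [rewrite r0 ltW|rewrite q1E; move: ep0; lra].
apply: (le_trans (integral_truncated_power_le a0 _ (measurable_window l x r))).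
  by move: q10; lra.
rewrite lee_fin mulrA ler_pM2r ?invr_gt0//.
apply: (@le_trans _ _ 1).
  by rewrite -[leRHS](powRr0 a); apply: ger_powR; [rewrite a0 a1|exact: ltW].
have : 1 <= r `^ lambda.
  by rewrite -[leLHS](powRr0 r); apply: ler_powR => //; case/andP : lambda01.
by lra.
Qed.

Lemma truncated_power_in_morrey : morrey p lambda E f.
Proof.
split; first exact: measurable_truncated_power.
by apply: le_lt_trans truncated_power_morrey _; rewrite ltry.
Qed.

(** Testing the Morrey norm on the single window of radius [rho] around the
    origin. The factor [(q + 1)^-1] matches the one of
    [truncated_power_morrey], and cancels when the two bounds are compared. *)
Lemma morrey_norm_lower_bound g (N kappa rho : R) :
  0 <= N -> 0 <= kappa -> 0 < rho -> (rho%:E < l)%E -> measurable_fun E g ->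
  (morrey_norm p lambda E g <= N%:E)%E ->
  (forall y, 0 < y -> y < rho -> kappa * y `^ (gamma + e) <= g y) ->
  (kappa * rho `^ e) `^ p / (q + 1) <= N `^ p.
Proof.
move=> N0 k0 rho0 rhol mg /(morrey_norm_leP _ _ _ p0 N0) gN gk.
have Ex : segment0 l 0.
  by rewrite /segment0/= lexx (le_trans _ (ltW rhol))// lee_fin ltW.
have := gN 0 rho Ex rho0.
have sub : `]0, rho[ `<=` window l 0 rho.
  move=> y /=; rewrite in_itv/= => /andP[y0 yr]; split; last first.
    by rewrite subr0 gtr0_norm.
  rewrite /segment0/= lee_fin ltW//=; apply: ltW; apply: lt_trans rhol.
  by rewrite lte_fin.
have mW := measurable_window l 0 rho.
have mgW : measurable_fun (window l 0 rho) (fun y => (`|g y| `^ p)%:E).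
  apply: measurable_norm_powR; apply: measurable_funS mg; last exact: window_sub.
  exact: measurable_segment0.
have lower : ((kappa `^ p * (rho `^ (q + 1) / (q + 1)))%:E <=
    \int[mu]_(y in window l 0 rho) (`|g y| `^ p)%:E)%E.
  apply: (@le_trans _ _ (\int[mu]_(y in `]0%R, rho[) (`|g y| `^ p)%:E)%E); last first.
    by apply: ge0_subset_integral => // y _; rewrite lee_fin powR_ge0.
  rewrite EFinM -integral_powR0//; last by move: q10; lra.
  rewrite -ge0_integralZl//; last 3 first.
  - exact: measurable_powR_EFin.
  - by move=> y _; rewrite lee_fin powR_ge0.
  - by rewrite lee_fin powR_ge0.
  apply: ge0_le_integral => //.
  - by move=> y _; rewrite mule_ge0// lee_fin powR_ge0.
  - by apply: measurable_funeM; exact: measurable_powR_EFin.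
  - exact: measurable_funS mgW.
  - move=> y; rewrite /= in_itv/= => /andP[y0 yr].
    rewrite -EFinM lee_fin -gammaE powRrM -powRM ?powR_ge0//.
    apply: ge0_ler_powR; rewrite ?nnegrE ?mulr_ge0 ?powR_ge0//; first exact: ltW.
    by rewrite (le_trans (gk _ y0 yr))// ler_norm.
move=> /(le_trans lower); rewrite lee_fin q1E powRD; last first.
  by apply/implyP => _; rewrite gt_eqF.
rewrite powRM ?powR_ge0// -powRrM -!mulrA mulrCA ler_pM2l ?powR_gt0//.
Qed.

End epsilon.

(** An operator that multiplies the test function of parameter [e] by at least
    [e^-1] near the origin has norm at least a constant times [e^-1]. The
    neighbourhood may shrink as fast as [2 `^ (- e^-1)], because the contribution
    of radius [rho] only loses the factor [rho `^ e], which stays above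
    [a / 2]. *)
Lemma not_morrey_bounded (defined : (R -> R) -> Prop) T :
  (forall e, 0 < e -> e * p < 1 - lambda ->
    defined (truncated_power a (gamma + e)) ->
    forall y, 0 < y -> y < a * 2 `^ (- e^-1) ->
      e^-1 * y `^ (gamma + e) <= T (truncated_power a (gamma + e)) y) ->
  ~ morrey_bounded p lambda E defined T.
Proof.
move=> lower [dm [C CT]].
have [C' C'1 C'C] : exists2 C' : R, 1 <= C' & C <= C'.
  by exists (Num.max 1 C); rewrite le_max lexx ?orbT.
have [l0 l1] := andP lambda01.
(* Small enough for [e * p < 1 - lambda] and for contradicting the inequality
   [a / 2 <= 3 * (e * C')] that the boundedness implies below. *)
pose e := (1 - lambda) * a / (12 * C' * p).
have D0 : 0 < 12 * C' * p by rewrite !mulr_gt0// (lt_le_trans ltr01).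
have e0 : 0 < e by rewrite divr_gt0// mulr_gt0// subr_gt0.
have eE : e * (12 * C' * p) = (1 - lambda) * a by rewrite divfK// gt_eqF.
have ep0 : 0 < e * p by rewrite mulr_gt0.
have ep_le : e * p <= e * p * C' by rewrite ler_peMr// ltW.
have e_le : e * C' <= e * p * C'.
  by rewrite ler_pM2r ?(lt_le_trans ltr01)// ler_peMr// ltW.
have epC : 12 * (e * p * C') = (1 - lambda) * a by rewrite -eE; ring.
have la0 : 0 < (1 - lambda) * a by rewrite mulr_gt0// subr_gt0.
have lam_a : (1 - lambda) * a <= 1 - lambda by rewrite ler_piMr// subr_ge0 ltW.
have lam_a' : (1 - lambda) * a <= a by rewrite ler_piMl// ?(ltW a0)//; lra.
have ep : e * p < 1 - lambda by lra.
have eC : 6 * (e * C') < a by lra.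
have le1 : e <= 1 by have : e <= e * p by [rewrite ler_peMr// ltW]; lra.
pose f := truncated_power a (gamma + e).
have fM := truncated_power_in_morrey e0 ep.
have [df [mT _]] := dm _ fM.
have q10 : 0 < lambda + e * p - 1 + 1 by lra.
set Q := lambda + e * p - 1 + 1 in q10.
pose M := (3 / Q) `^ p^-1.
have M0 : 0 <= M by exact: powR_ge0.
have TN : (morrey_norm p lambda E (T f) <= (C' * M)%:E)%E.
  apply: (le_trans (CT _ fM)); rewrite EFinM.
  have nf0 : (0 <= morrey_norm p lambda E f)%E.
    by apply: morrey_norm_ge0; apply: ltW; apply: lt_trans al; rewrite lte_fin.
  apply: (@le_trans _ _ (C'%:E * morrey_norm p lambda E f)%E).
    by apply: lee_wpmul2r; rewrite ?lee_fin.
  apply: lee_wpmul2l; first by rewrite lee_fin (le_trans ler01).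
  exact: truncated_power_morrey.
pose rho := a * 2 `^ (- e^-1).
have rho0 : 0 < rho by rewrite mulr_gt0// powR_gt0.
have rhoa : rho <= a.
  rewrite ger_pMr// powRN invf_le1 ?powR_gt0//.
  have := @ler_powR R 2 _ 0 e^-1; rewrite powRr0; apply; first by rewrite ler1n.
  by rewrite invr_ge0 ltW.
have rhol : (rho%:E < l)%E by apply: le_lt_trans al; rewrite lee_fin.
have rhoe : a / 2 <= rho `^ e.
  rewrite powRM ?powR_ge0 ?(ltW a0)// -powRrM mulNr mulVf ?gt_eqF//.
  rewrite powR_inv1// ler_pM2r ?invr_gt0//.
  by rewrite -[leLHS](powRr1 (ltW a0)); apply: ger_powR; rewrite ?a0.
have C'0 : 0 <= C' by lra.
have := morrey_norm_lower_bound e0 (mulr_ge0 C'0 M0) _ rho0 rhol mT TN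
  (lower e e0 ep df).
rewrite invr_ge0 ltW// => /(_ isT).
have MP : (C' * M) `^ p = C' `^ p * 3 / Q.
  by rewrite powRM// -mulrA /M -powRrM mulVf ?gt_eqF// powRr1// divr_ge0// ltW.
rewrite -/Q MP ler_pM2r ?invr_gt0// => h.
have : (e^-1 * rho `^ e) `^ p <= (3 * C') `^ p.
  apply: (le_trans h); rewrite powRM// mulrC ler_wpM2r ?powR_ge0//.
  by rewrite le1r_powR// ler1n.
have nn1 : 0 <= e^-1 * rho `^ e by rewrite mulr_ge0 ?invr_ge0 ?powR_ge0// ltW.
have nn2 : 0 <= 3 * C' by rewrite mulr_ge0.
move=> /(@ge0_ler_powR _ p^-1); rewrite !nnegrE !powR_ge0 invr_ge0 (ltW p0).
move=> /(_ isT isT isT); rewrite -!powRrM divff ?gt_eqF// !powRr1// => h2.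
have : a / 2 <= 3 * (e * C').
  by apply: (le_trans rhoe); rewrite mulrCA -ler_pdivrMl.
rewrite ler_pdivrMr// => /(lt_le_trans eC).
by rewrite (_ : 3 * (e * C') * 2 = 6 * (e * C')) ?ltxx//; ring.
Qed.

(** The average over [S] is bounded below by the part over [S'], where the dilates
    of the test function are not truncated. The integrability hypothesis matters
    because a divergent integral takes the value [0] as a real number. *)
Lemma operator_truncated_power_ge (b e y : R) (S S' : set R)
    (T : (R -> R) -> R -> R) :
  let f := truncated_power a (gamma + e) in
  measurable S -> measurable S' -> (forall s, S s -> 0 < s) -> S' `<=` S ->
  (forall g z, segment0 l z -> 0 < z ->
    T g z = kernel_operator S l b g z) ->
  mu.-integrable (kernel_support S l y) (fun t => (f t / t `^ b)%:E) ->
  0 < e -> 0 < y -> y < a ->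
  (forall s, S' s -> y * s < a /\ s `^ (e - 1) <= s `^ (gamma + e - b)) ->
  (e^-1%:E <= \int[mu]_(s in S') (s `^ (e - 1))%:E)%E ->
  e^-1 * y `^ (gamma + e) <= T f y.
Proof.
move=> f mS mS' S0 S'S TE fint e0 y0 ya S'a intS'.
have mf : measurable_fun (segment0 l) f by exact: measurable_truncated_power.
have Ey : segment0 l y.
  rewrite /segment0/= lee_fin ltW//=; apply: ltW; apply: lt_trans al.
  by rewrite lte_fin.
rewrite (operator_average mS S0 TE)//.
set A := average _ _ _ _.
have fI : f \_ (open_segment0 l) = f.
  apply/funext => t; rewrite patchE; case: ifPn => // tI.
  rewrite /f /truncated_power patchE; case: ifPn => //.
  rewrite inE/= in_itv/= => /andP[t0 ta]; move/negP : tI; case.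
  by rewrite inE /open_segment0/= lte_fin t0 (lt_trans _ al)// lte_fin.
have Alow : ((e^-1 * y `^ (gamma + e))%:E <= A)%E.
  rewrite mulrC EFinM.
  apply: (@le_trans _ _ ((y `^ (gamma + e))%:E *
      \int[mu]_(s in S') (s `^ (e - 1))%:E)%E).
    by apply: lee_wpmul2l => //; rewrite lee_fin powR_ge0.
  rewrite -ge0_integralZl//; last 3 first.
  - exact: measurable_powR_EFin.
  - by move=> s _; rewrite lee_fin powR_ge0.
  - by rewrite lee_fin powR_ge0.
  have mA (D : set R) : measurable_fun D (fun s => (f (y * s) * s `^ (- b))%:E).
    apply/measurable_EFinP; apply: measurable_funTS; apply: measurable_funM.
      apply: (@measurableT_comp _ _ _ _ _ _ f); first exact: measurable_truncated_power.
      exact: mulrl_measurable.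
    exact: measurable_powR.
  apply: (@le_trans _ _ (\int[mu]_(s in S') (f (y * s) * s `^ (- b))%:E)%E).
    apply: ge0_le_integral => //.
    - by move=> s _; rewrite mule_ge0// lee_fin powR_ge0.
    - by apply: measurable_funeM; exact: measurable_powR_EFin.
    - exact: mA.
    - move=> s S's; have [ysa hs] := S'a _ S's.
      have s0 := S0 _ (S'S _ S's).
      rewrite -EFinM lee_fin /f truncated_powerE ?mulr_gt0//.
      rewrite powRM ?(ltW y0) ?(ltW s0)// -mulrA -powRD; last first.
        by apply/implyP => _; rewrite gt_eqF.
      by rewrite ler_pM2l ?powR_gt0.
  rewrite /A fI /average; apply: ge0_subset_integral => //; first exact: mA.
  by move=> s _; rewrite lee_fin mulr_ge0 ?powR_ge0 ?truncated_power_ge0.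
have Afin : A \is a fin_num.
  have := @integrable_lty _ (measurableTypeR R) R mu _
    (measurable_kernel_support l y mS) _ fint.
  rewrite (integral_kernel_support b mS S0 mf y0) -/A.
  have : (0 <= A)%E.
    by apply: (le_trans _ Alow); rewrite lee_fin mulr_ge0 ?powR_ge0 ?invr_ge0 ?(ltW e0).
  case: A {Alow} => [||]// _.
  by rewrite gt0_muley ?lte_fin ?powR_gt0.
by rewrite -lee_fin fineK.
Qed.

End necessity.

(** * The Hardy operators *)

Section hardy_operators.
Context {R : realType}.
Variables (l : \bar R) (p lambda beta : R).
Hypotheses (l0 : (0 < l)%E) (p1 : 1 <= p) (lambda01 : 0 <= lambda < 1).
Local Notation mu := (@lebesgue_measure R).

Lemma open_segment0_point : exists a : R, [/\ 0 < a, a <= 1 & (a%:E < l)%E].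
Proof.
case: l l0 => [r||]//; last by exists 1; rewrite ltry.
rewrite lte_fin => r0; exists (Num.min 1 (r / 2)).
rewrite lt_min ltr01 divr_gt0// ge_min lexx; split => //.
by rewrite lte_fin gt_min; apply/orP; right; lra.
Qed.

Lemma kernel_support_hardy y : segment0 l y -> 0 < y ->
  kernel_support `]0, 1[ l y = `]0, y[%classic.
Proof.
move=> /andP[_ yl] y0; apply/seteqP; split => t; rewrite /kernel_support/= !in_itv/=.
  move=> [_ /andP[]]; rewrite pmulr_lgt0 ?invr_gt0// => ->.
  by rewrite ltr_pdivrMr// mul1r.
move=> /andP[t0 ty]; split; last by rewrite divr_gt0// ltr_pdivrMr// mul1r.
by rewrite /open_segment0/= lte_fin t0 (lt_le_trans _ yl)// lte_fin.
Qed.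

Lemma kernel_support_hardy_dual y : 0 < y ->
  kernel_support `]1, +oo[ l y = [set t : R | (y%:E < t%:E < l)%E].
Proof.
move=> y0; apply/seteqP; split => t; rewrite /kernel_support/= in_itv/= andbT.
  by move=> [/andP[_ ->]]; rewrite ltr_pdivlMr// mul1r lte_fin andbT.
move=> /andP[yt tl]; rewrite lte_fin in yt.
split; last by rewrite ltr_pdivlMr// mul1r.
by rewrite /open_segment0/= lte_fin tl (lt_trans y0).
Qed.

Lemma hardyE f y : segment0 l y -> 0 < y -> 
  hardy beta f y = kernel_operator `]0, 1[ l beta f y.
Proof. by move=> ly y0; rewrite /kernel_operator kernel_support_hardy. Qed.

Lemma hardy_dualE f y : segment0 l y -> 0 < y -> 
  hardy_dual l beta f y = kernel_operator `]1, +oo[ l (beta + 1) f y.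
Proof.
by move=> _ y0; rewrite /kernel_operator kernel_support_hardy_dual// addrK.
Qed.

Lemma hardy_bounded : beta < (lambda - 1) / p + 1 ->
  morrey_bounded p lambda (segment0 l) (hardy_defined l beta) (hardy beta).
Proof.
move=> hb.
apply: (@operator_bounded _ l p lambda beta
  ((lambda - 1) / p - beta + 1)^-1 `]0, 1[%classic) => //.
- by move=> s /=; rewrite in_itv/= => /andP[].
- exact: hardyE.
- move=> f fint y /andP[]; rewrite lte_fin => y0 yl.
  have ly : open_segment0 l y by rewrite /open_segment0/= lte_fin y0.
  by have := fint y ly; rewrite kernel_support_hardy//; exact: open_segment0_sub.
- move=> y /andP[]; rewrite lte_fin => y0 yl.
  have [v yv vl] : exists2 v, y < v & (v%:E <= l)%E.
    case: l l0 yl => [r||]// _ yr; first by exists r.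
    by exists (y + 1); rewrite ?ltrDl ?leey.
  exists y, v; split => //.
    move=> z /=; rewrite in_itv/= => /andP[yz zv].
    by rewrite /open_segment0/= lte_fin (lt_trans y0)// (lt_le_trans _ vl).
  move=> z; rewrite in_itv/= => /andP[yz _] t [It] /=; rewrite in_itv/= => /andP[_].
  rewrite ltr_pdivrMr// mul1r => ty; split => //=; rewrite in_itv/=.
  have z0 : 0 < z by rewrite (lt_trans y0).
  case/andP : It => t0 _.
  by rewrite divr_gt0// ltr_pdivrMr// mul1r (lt_trans ty).
- rewrite integral_powR0//; last by lra.
  by rewrite powR1 div1r.
Qed.

Lemma hardy_dual_bounded : (lambda - 1) / p < beta ->
  morrey_bounded p lambda (segment0 l) (hardy_dual_defined l beta)
    (hardy_dual l beta).
Proof.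
move=> hb; pose c := (lambda - 1) / p - (beta + 1).
have c1 : c < -1 by rewrite /c; lra.
have kfin := integral_powRy_lty c1.
have k0 : (0 <= \int[mu]_(s in `]1%R, +oo[) (s `^ c)%:E)%E.
  by apply: integral_ge0 => s _; rewrite lee_fin powR_ge0.
apply: (@operator_bounded _ l p lambda (beta + 1)
  (fine (\int[mu]_(s in `]1%R, +oo[) (s `^ c)%:E)) `]1, +oo[%classic) => //.
- by move=> s /=; rewrite in_itv/= andbT; exact: lt_trans.
- exact: hardy_dualE.
- move=> f fint y /andP[]; rewrite lte_fin => y0 yl.
  have ly : open_segment0 l y by rewrite /open_segment0/= lte_fin y0.
  by have := fint y ly; rewrite kernel_support_hardy_dual.
- move=> y /andP[]; rewrite lte_fin => y0 yl; exists 0, y; split => //.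
    move=> z /=; rewrite in_itv/= => /andP[z0 zy].
    by rewrite /open_segment0/= lte_fin z0 (lt_trans _ yl)// lte_fin.
  move=> z; rewrite in_itv/= => /andP[z0 zy] t [It] /=; rewrite !in_itv/= !andbT.
  rewrite ltr_pdivlMr// mul1r => yt; split => //=.
  by rewrite in_itv/= andbT ltr_pdivlMr// mul1r (lt_trans zy).
- by rewrite fineK// ge0_fin_numE.
Qed.

(** At or above the critical exponent, the kernel integral of a test function is at
    least the integral of [s `^ (e - 1)] over [`]0, 1[], which is [e^-1]. *)
Lemma hardy_unbounded : (lambda - 1) / p + 1 <= beta ->
  ~ morrey_bounded p lambda (segment0 l) (hardy_defined l beta) (hardy beta).
Proof.
move=> hb; have [a [a0 a1 al]] := open_segment0_point.
apply: (not_morrey_bounded p1 lambda01 a0 a1 al) => e e0 ep df y y0 ya.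
have ya' : y < a.
  apply: lt_le_trans ya _; rewrite ger_pMr// powRN invf_le1 ?powR_gt0//.
  rewrite -[leLHS](powRr0 2); apply: ler_powR; rewrite ?ler1n// invr_ge0.
  exact: ltW.
have yl : (y%:E < l)%E by apply: lt_trans al; rewrite lte_fin.
have Iy : open_segment0 l y by rewrite /open_segment0/= lte_fin y0.
apply: (@operator_truncated_power_ge _ l p lambda a al beta e y
  `]0, 1[%classic `]0, 1[%classic) => //.
- by move=> s /=; rewrite in_itv/= => /andP[].
- exact: hardyE.
- by rewrite kernel_support_hardy//; [exact: df|exact: open_segment0_sub].
- move=> s /=; rewrite in_itv/= => /andP[s0 s1]; split.
    by apply: le_lt_trans ya'; rewrite ger_pMr// ltW.
  by apply: ger_powR; [rewrite s0 ltW|lra].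
- rewrite integral_powR0//; last by lra.
  by rewrite powR1 subrK div1r.
Qed.

(** At or below the critical exponent, the kernel integral is at least the integral
    of [s `^ (e - 1)] over [`]1, a / y[], the range where the dilated test function
    is not truncated. It is at least [e^-1] once [(a / y) `^ e] is at least [2],
    that is for [y] below [a * 2 `^ (- e^-1)]. *)
Lemma hardy_dual_unbounded : beta <= (lambda - 1) / p ->
  ~ morrey_bounded p lambda (segment0 l) (hardy_dual_defined l beta)
      (hardy_dual l beta).
Proof.
move=> hb; have [a [a0 a1 al]] := open_segment0_point.
apply: (not_morrey_bounded p1 lambda01 a0 a1 al) => e e0 ep df y y0 ya.
have two : 1 < (2 : R) `^ e^-1.
  rewrite /powR pnatr_eq0/= -[ltLHS]expR0 ltr_expR mulr_gt0 ?invr_gt0//.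
  by apply: ln_gt0; rewrite ltr1n.
have y2a : 2 `^ e^-1 < a / y.
  rewrite ltr_pdivlMr// mulrC -ltr_pdivlMr ?powR_gt0//.
  by rewrite -powRN.
have ya' : y < a by move: (lt_trans two y2a); rewrite ltr_pdivlMr// mul1r.
have yl : (y%:E < l)%E by apply: lt_trans al; rewrite lte_fin.
have Iy : (0%R%:E < y%:E < l)%E by rewrite lte_fin y0.
apply: (@operator_truncated_power_ge _ l p lambda a al (beta + 1) e y
  `]1, +oo[%classic `]1, a / y[%classic) => //.
- by move=> s /=; rewrite in_itv/= andbT; exact: lt_trans.
- by move=> s /=; rewrite !in_itv/= andbT => /andP[].
- exact: hardy_dualE.
- by rewrite kernel_support_hardy_dual//; exact: df.
- move=> s /=; rewrite in_itv/= => /andP[s1 sa]; split.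
    by rewrite mulrC -ltr_pdivlMr.
  by apply: ler_powR; [exact: ltW|lra].
- rewrite integral_powR//; last 2 first.
  + exact: lt_trans two y2a.
  + by rewrite subrK gt_eqF.
  rewrite lee_fin subrK powR1 -[leLHS]mul1r ler_pM2r ?invr_gt0//.
  have : (2 : R) <= (a / y) `^ e.
    rewrite -[leLHS]powRr1// -[X in 2 `^ X](@mulVf _ e) ?gt_eqF// powRrM.
    by apply: ge0_ler_powR;
      rewrite ?nnegrE ?powR_ge0 ?divr_ge0 ?(ltW e0) ?(ltW a0) ?(ltW y0) ?(ltW y2a).
  by lra.
Qed.

End hardy_operators.

Theorem theorem3p1 (R : realType) (l : \bar R) (p lambda beta : R)
    (p' : \bar R) (hl : (0 < l)%E) (hp : 1 <= p)
    (hlambda : 0 <= lambda < 1) (hp' : ((p%:E)^-1 + p'^-1 = 1)%E) :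
  (morrey_bounded p lambda (segment0 l) (hardy_defined l beta) (hardy beta)
     <-> (beta%:E < (lambda / p)%:E + p'^-1)%E) /\
  (morrey_bounded p lambda (segment0 l) (hardy_dual_defined l beta)
     (hardy_dual l beta)
     <-> lambda / p - p^-1 < beta).
Proof.
have gammaE : lambda / p - p^-1 = (lambda - 1) / p by rewrite mulrBl mul1r.
have -> : (p'^-1 = (1 - p^-1)%:E)%E.
  move: hp'; rewrite inver gt_eqF ?(lt_le_trans ltr01)//.
  by case: (p'^-1)%E => [q||]//; rewrite -EFinD => -[<-]; rewrite addrC addKr.
rewrite -EFinD lte_fin addrA addrAC gammaE; split; split.
- move=> bdd; rewrite ltNge; apply/negP => h.
  exact: hardy_unbounded hl hp hlambda h bdd.
- exact: hardy_bounded.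
- move=> bdd; rewrite ltNge; apply/negP => h.
  exact: hardy_dual_unbounded hl hp hlambda h bdd.
- exact: hardy_dual_bounded.
Qed.
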